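(* Let $k,m\ge 1$ be integers, let $n=k+m$, and let $A_n=\{1,\dots,n\}$ be partitioned into the two disjoint antichains $A_k=\{1,\dots,k\}$ and $A_m=\{k+1,\dots,n\}$. Let $\pi$ be a permutation of $A_k$ and $\rho$ a permutation of $A_m$, and let $\pi\circ\rho$ denote the permutation of $A_n$ that acts as $\pi$ on $A_k$ and as $\rho$ on $A_m$. Suppose that the length of each cycle of $\pi$ is coprime to the length of every cycle of $\rho$. Then there are isomorphisms of posets $$\mathrm{Fix}(\pi\circ\rho,D_n)\;\cong\;\mathrm{Fix}(\pi,D_k)^{\mathrm{Cycl}(\rho,B^m)}\;\cong\;\mathrm{Fix}(\rho,D_m)^{\mathrm{Cycl}(\pi,B^k)}.$$
   Context: $B=\{0,1\}$ with $0\le 1$. For a finite set $A$ (regarded as an antichain), $B^A$ is the set of all functions $A\to B$ with the pointwise (componentwise) order; $B^n=B^{\{1,\dots,n\}}$. Here $B^k$ means $B^{A_k}$ and $B^m$ means $B^{A_m}$, with $A_m=\{k+1,\dots,n\}$. For posets $S,T$, $T^S$ denotes the poset of all monotone (order-preserving) functions $S\to T$ with pointwise order: $f\le g$ iff $f(x)\le g(x)$ for all $x\in S$. $D_n=B^{B^n}$ is the poset of monotone Boolean functions of $n$ variables (likewise $D_k=B^{B^k}$ and $D_m=B^{B^m}$, with $B^k=B^{A_k}$, $A_k=\{1,\dots,k\}$, and $B^m=B^{A_m}$, $A_m=\{k+1,\dots,n\}$). A permutation $\sigma$ of a finite set $A$ acts on $B^A$ by $\sigma(x)=x\circ\sigma$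 (elements $x\in B^A$ being functions $A\to\{0,1\}$), and acts on monotone functions $g:B^A\to B$ by $\sigma(g)=g\circ\sigma$, i.e. $\sigma(g)(x)=g(\sigma(x))$. $\mathrm{Fix}(\sigma,\cdot)$ denotes the set of monotone Boolean functions $g$ with $\sigma(g)=g$, ordered by the pointwise order inherited from the poset of monotone Boolean functions. $\mathrm{Cycl}(\sigma,B^A)$ denotes the set of cycles (orbits, including those of length 1) of the permutation $\sigma$ acting on $B^A$, each cycle being identified with its set of elements, partially ordered by: $C\le C'$ iff there exist $x\in C$ and $y\in C'$ with $x\le y$. Cycles of a permutation include its fixed points as cycles of length 1. *)

(* Defs.v *)
From HB Require Import structures.
From mathcomp Require Import all_boot all_order all_fingroup.

Set Implicit Arguments.
Unset Strict Implicit.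
Unset Printing Implicit Defensive.

Import Order.TTheory.
Local Open Scope order_scope.

Definition poset_iso (d d' : Order.disp_t)
    (S : porderType d) (T : porderType d') : Prop :=
  exists f : S -> T, bijective f /\ {mono f : x y / x <= y}.

Fact pointwise_display : Order.disp_t. Proof. exact: (Order.Disp tt tt). Qed.

Section PointwiseOrder.
Variables (d : Order.disp_t) (A : finType) (T : porderType d).
Implicit Types f g h : {ffun A -> T}.

Definition ffun_le f g := [forall a, f a <= g a].

Lemma ffun_le_refl : reflexive ffun_le.
Proof. by move=> f; apply/forallP => a. Qed.

Lemma ffun_le_anti : antisymmetric ffun_le.
Proof.
move=> f g /andP[/forallP fg /forallP gf]; apply/ffunP => a.
by apply: le_anti; rewrite fg gf.
Qed.

Lemma ffun_le_trans : transitive ffun_le.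
Proof.
move=> g f h /forallP fg /forallP gh; apply/forallP => a.
exact: le_trans (fg a) (gh a).
Qed.

HB.instance Definition _ := Order.Le_isPOrder.Build pointwise_display
  {ffun A -> T} ffun_le_refl ffun_le_anti ffun_le_trans.

End PointwiseOrder.

HB.instance Definition _ (d : Order.disp_t) (A : finType)
    (T : finPOrderType d) :=
  Order.POrder.on {ffun A -> T}.

(* The poset T^S of monotone functions; S is finite so that monotonicity is
   decidable and equality of functions is extensional. *)
Section MonotoneFunctions.
Variables (d d' : Order.disp_t) (S : finPOrderType d) (T : porderType d').

Record monofun := MonoFun {
  mfun :> {ffun S -> T};
  _ : [forall x, forall y, (x <= y) ==> (mfun x <= mfun y)] }.

HB.instance Definition _ := [isSub for mfun].
HB.instance Definition _ := [Choice of monofun by <:].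
HB.instance Definition _ :=
  [SubChoice_isSubPOrder of monofun by <: with pointwise_display].

Lemma monofunP (f : monofun) : {homo f : x y / x <= y}.
Proof. by case: f => f /= /'forall_forallP H x y; apply/implyP/H. Qed.

Lemma le_monofunE (f g : monofun) : (f <= g) = [forall x, f x <= g x].
Proof. by []. Qed.

End MonotoneFunctions.

Notation cube A := {ffun A -> bool}.

Notation mbf A := (monofun (cube A) bool).

Section PermutationAction.
Variables (A : finType) (s : {perm A}).

Definition cube_act (x : cube A) : cube A := [ffun a => x (s a)].

Lemma cube_act_inj : injective cube_act.
Proof.
move=> x y /ffunP xy; apply/ffunP => a.
by have := xy (s^-1%g a); rewrite !ffunE permKV.
Qed.

Definition cube_perm : {perm cube A} := perm cube_act_inj.

Lemma cube_perm_le (x y : cube A) :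
  x <= y -> cube_perm x <= cube_perm y.
Proof.
move=> /forallP xy; apply/forallP => a.
by rewrite !permE !ffunE.
Qed.

Fact mbf_act_subproof (g : mbf A) :
  let h := [ffun x => g (cube_perm x)] in
  [forall x, forall y, (x <= y) ==> (h x <= h y)].
Proof.
apply/'forall_forallP => x y; apply/implyP => xy.
by rewrite !ffunE; apply/monofunP/cube_perm_le.
Qed.

Definition mbf_act (g : mbf A) : mbf A := MonoFun (mbf_act_subproof g).

Record fix_mbf := FixMbf { fix_val :> mbf A; _ : mbf_act fix_val == fix_val }.

HB.instance Definition _ := [isSub for fix_val].
HB.instance Definition _ := [Choice of fix_mbf by <:].
HB.instance Definition _ :=
  [SubChoice_isSubPOrder of fix_mbf by <: with pointwise_display].

Lemma le_fix_mbfE (f g : fix_mbf) : (f <= g) = [forall x, f x <= g x].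
Proof. by []. Qed.

Lemma fix_mbfP (g : mbf A) :
  reflect (forall x, g (cube_perm x) = g x) (mbf_act g == g).
Proof.
apply: (iffP eqP) => [gE x|gE]; first by rewrite -[in RHS]gE /= ffunE.
by apply: val_inj; apply/ffunP => x; rewrite ffunE.
Qed.

Record cycl := Cycl {
  cycl_set :> {set cube A};
  _ : cycl_set \in porbits cube_perm }.

HB.instance Definition _ := [isSub for cycl_set].
HB.instance Definition _ := [Finite of cycl by <:].

Definition cycl_le (C C' : cycl) :=
  [exists x in cycl_set C, exists y in cycl_set C', x <= y].

Lemma cycl_leP (C C' : cycl) :
  reflect (exists x y, [/\ x \in cycl_set C, y \in cycl_set C' & x <= y])
          (cycl_le C C').
Proof.
apply: (iffP exists_inP) => [[x xC /exists_inP[y yC xy]]|[x [y [xC yC xy]]]].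
  by exists x, y.
by exists x => //; apply/exists_inP; exists y.
Qed.

Lemma cube_permX_le n (x y : cube A) :
  x <= y -> (cube_perm ^+ n)%g x <= (cube_perm ^+ n)%g y.
Proof.
move=> xy; elim: n => [|n IHn]; first by rewrite expg0 !perm1.
by rewrite expgSr !permM; apply: cube_perm_le.
Qed.

Lemma cyclE (C : cycl) x : x \in cycl_set C -> cycl_set C = porbit cube_perm x.
Proof.
case: C => C /= /imsetP[y _ ->]; rewrite -eq_porbit_mem => /eqP.
by move=> ->.
Qed.

Lemma cycl_le_refl : reflexive cycl_le.
Proof.
case=> C C_orb; have /imsetP[x _ Cx] := C_orb.
apply/cycl_leP; exists x, x; split=> //=; by rewrite Cx porbit_id.
Qed.

Lemma cycl_le_trans : transitive cycl_le.
Proof.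
move=> C' C C'' /cycl_leP[x [y [xC yC' xy]]] /cycl_leP[y' [z [y'C' zC'' yz]]].
move: y'C'; rewrite (cyclE yC') => /porbitPmin[i _ y'E].
have [j yE] : exists j, y = (cube_perm ^+ j)%g y'.
  have : y \in porbit cube_perm y' by rewrite y'E porbit_sym mem_porbit.
  by case/porbitP => j; exists j.
apply/cycl_leP; exists x, ((cube_perm ^+ j)%g z); split=> //.
  by rewrite (cyclE zC'') mem_porbit.
by apply: le_trans xy _; rewrite yE; apply: cube_permX_le.
Qed.

Lemma cube_permX_le_eq n (x : cube A) :
  x <= (cube_perm ^+ n)%g x -> (cube_perm ^+ n)%g x = x.
Proof.
move=> x_le; set t := (cube_perm ^+ n)%g in x_le *.
have t_le i : t x <= (t ^+ i.+1)%g x.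
  elim: i => [|i IHi]; first by rewrite expg1.
  apply: le_trans IHi _; rewrite [in X in _ <= X]expgS permM.
  by rewrite -expgM; apply: cube_permX_le.
apply: le_anti; rewrite x_le andbT.
by have := t_le #[t]%g.-1; rewrite prednK ?order_gt0 // expg_order perm1.
Qed.

Lemma cycl_le_anti : antisymmetric cycl_le.
Proof.
move=> C C' /andP[/cycl_leP[x [y [xC yC' xy]]] /cycl_leP[y' [x' [y'C' x'C yx]]]].
move: y'C' x'C; rewrite (cyclE yC') (cyclE xC) => /porbitP[i y'E] /porbitP[j x'E].
have /porbitP[l yE] : y \in porbit cube_perm y'.
  by rewrite y'E porbit_sym mem_porbit.
have yx' : y <= (cube_perm ^+ (j + l))%g x.
  by rewrite expgD permM -x'E yE; apply: cube_permX_le.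
have xE := cube_permX_le_eq (le_trans xy yx').
have yx0 : y = x by apply: le_anti; rewrite xy -{1}xE yx'.
by apply: val_inj => /=; rewrite (cyclE yC') (cyclE xC) yx0.
Qed.

HB.instance Definition _ := Order.Le_isPOrder.Build pointwise_display
  cycl cycl_le_refl cycl_le_anti cycl_le_trans.

Lemma le_cyclE (C C' : cycl) :
  (C <= C') = [exists x in cycl_set C, exists y in cycl_set C', x <= y].
Proof. by []. Qed.

End PermutationAction.

Section BlockPermutation.
Variables (k m : nat) (p : 'S_k) (r : 'S_m).

Definition block_fun (i : 'I_(k + m)) : 'I_(k + m) :=
  match split i with
  | inl a => lshift m (p a)
  | inr b => rshift k (r b)
  end.

Lemma block_fun_inj : injective block_fun.
Proof.
move=> i j; rewrite /block_fun -[i]splitK -[j]splitK !unsplitK.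
case: (split i) => a; case: (split j) => b //=.
- by move/lshift_inj/perm_inj ->.
- by move/eqP; rewrite eq_lrshift.
- by move/eqP; rewrite eq_rlshift.
- by move/rshift_inj/perm_inj ->.
Qed.

(* The permutation of {1..k+m} acting as p on the first k points and as r on
   the last m; {k+1..k+m} is represented by 'I_m through rshift. *)
Definition block_perm : 'S_(k + m) := perm block_fun_inj.

End BlockPermutation.

(* Main.v *)
Require Import Defs.
From mathcomp Require Import all_boot all_order all_fingroup cyclic.

(** The whole argument is about the quotient of a cube by a permutation.
    The cycles of [s] on [cube A], with their order, form the quotient poset
    of [cube A] by the orbit relation: a monotone [s]-invariant map out of the
    cube is the same thing as a monotone map out of [cycl s] ([lift], [liftE],
    [homo_orb]).

    For the first isomorphism, write a point of the cube over [k + m]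
    coordinates as a pair [join x y], so that the block permutation acts
    componentwise.  Since every cycle length of [p] is coprime to every cycle
    length of [r], the orders of [p] and [r] are coprime
    ([coprime_perm_orders]), and by the Chinese remainder theorem some power of
    the block permutation acts as [p] on the left block and trivially on the
    right one, and another one does the opposite.  Hence a monotone function
    invariant under the block permutation is invariant under [p] and under [r]
    separately ([fix_block_left], [fix_block_right]).  Fixing [y] thus gives an
    element of [fix_mbf p] that depends on [y] in a monotone and [r]-invariant
    way, i.e. a monotone map from [cycl r] to [fix_mbf p]; conversely such a
    map can be evaluated at the two halves of any point ([fix_block_iso]).

    The second isomorphism is formal: the quotient property with values in
    [bool] says that [fix_mbf s] is the poset of monotone maps from [cycl s] to
    [bool] ([fix_mbf_iso]), so both sides are posets of monotone maps in two
    arguments, which may be exchanged ([flip_iso]). *)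

Set Implicit Arguments.
Unset Strict Implicit.
Unset Printing Implicit Defensive.

Import Order.TTheory.
Local Open Scope order_scope.

(** * Isomorphisms of posets *)

Lemma poset_iso_of_cancel (d d' : Order.disp_t) (S : porderType d)
    (T : porderType d') (f : S -> T) (g : T -> S) :
  {homo f : x y / x <= y} -> {homo g : x y / x <= y} ->
  cancel f g -> cancel g f -> poset_iso S T.
Proof.
move=> fM gM fK gK; exists f; split; first by exists g.
by move=> x y; apply/idP/idP => [/gM|/fM //]; rewrite !fK.
Qed.

Lemma poset_iso_sym (d d' : Order.disp_t) (S : porderType d)
    (T : porderType d') : poset_iso S T -> poset_iso T S.
Proof.
case=> f [[g fK gK] fM]; exists g; split; first by exists f.
by move=> x y; rewrite -fM !gK.
Qed.

Lemma poset_iso_trans (d d' d'' : Order.disp_t) (S : porderType d)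
    (T : porderType d') (U : porderType d'') :
  poset_iso S T -> poset_iso T U -> poset_iso S U.
Proof.
case=> f [f_bij fM] [g [g_bij gM]]; exists (g \o f).
by split=> [|x y /=]; [apply: bij_comp | rewrite gM fM].
Qed.

(** * Posets of monotone maps *)

Section MonotoneMaps.
Variables (d d' : Order.disp_t) (S : finPOrderType d) (T : porderType d').

Fact mono_fun_subproof (f : S -> T) : {homo f : x y / x <= y} ->
  [forall x, forall y, (x <= y) ==> ([ffun x => f x] x <= [ffun x => f x] y)].
Proof.
by move=> fM; apply/'forall_forallP => x y; apply/implyP; rewrite !ffunE => /fM.
Qed.

Definition mono_fun (f : S -> T) (fM : {homo f : x y / x <= y}) : monofun S T :=
  MonoFun (mono_fun_subproof fM).

Lemma mono_funE (f : S -> T) (fM : {homo f : x y / x <= y}) x :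
  mono_fun fM x = f x.
Proof. by rewrite /= ffunE. Qed.

Lemma monofun_ext (f g : monofun S T) : (forall x, f x = g x) -> f = g.
Proof. by move=> fg; apply/val_inj/ffunP. Qed.

Lemma le_monofunP (f g : monofun S T) :
  reflect (forall x, f x <= g x) (f <= g).
Proof. by rewrite le_monofunE; apply: forallP. Qed.

End MonotoneMaps.

Lemma monofun_iso (d d' d'' : Order.disp_t) (S : finPOrderType d)
    (T : porderType d') (U : porderType d'') :
  poset_iso T U -> poset_iso (monofun S T) (monofun S U).
Proof.
case=> f [[g fK gK] fM].
have gM : {mono g : x y / x <= y} by move=> x y; rewrite -fM !gK.
have fF (F : monofun S T) : {homo f \o F : x y / x <= y}.
  by move=> x y xy /=; rewrite fM monofunP.
have gF (F : monofun S U) : {homo g \o F : x y / x <= y}.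
  by move=> x y xy /=; rewrite gM monofunP.
apply: (@poset_iso_of_cancel _ _ _ _
         (fun F => mono_fun (fF F)) (fun F => mono_fun (gF F))).
- move=> F G /le_monofunP FG; apply/le_monofunP => x.
  by rewrite !mono_funE /= fM.
- move=> F G /le_monofunP FG; apply/le_monofunP => x.
  by rewrite !mono_funE /= gM.
- by move=> F; apply: monofun_ext => x; rewrite mono_funE /comp mono_funE /comp fK.
- by move=> F; apply: monofun_ext => x; rewrite mono_funE /comp mono_funE /comp gK.
Qed.

Section Flip.
Variables (d d' d'' : Order.disp_t).
Variables (S : finPOrderType d) (T : finPOrderType d') (U : porderType d'').

Fact flip_homo_in (F : monofun S (monofun T U)) y :
  {homo (fun x => F x y) : x x' / x <= x'}.
Proof. by move=> x x' /(@monofunP _ _ _ _ F)/le_monofunP. Qed.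

Fact flip_homo_out (F : monofun S (monofun T U)) :
  {homo (fun y => mono_fun (flip_homo_in F y)) : y y' / y <= y'}.
Proof.
by move=> y y' yy'; apply/le_monofunP => x; rewrite !mono_funE monofunP.
Qed.

Definition flip (F : monofun S (monofun T U)) : monofun T (monofun S U) :=
  mono_fun (flip_homo_out F).

Lemma flipE F x y : flip F y x = F x y.
Proof. by rewrite mono_funE mono_funE. Qed.

Lemma homo_flip : {homo flip : F G / F <= G}.
Proof.
move=> F G /le_monofunP FG; apply/le_monofunP => y; apply/le_monofunP => x.
by rewrite !flipE; move: (FG x) => /le_monofunP.
Qed.

End Flip.

Lemma flipK (d d' d'' : Order.disp_t) (S : finPOrderType d)
    (T : finPOrderType d') (U : porderType d'') :
  cancel (@flip _ _ _ S T U) (@flip _ _ _ T S U).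
Proof.
by move=> F; apply: monofun_ext => x; apply: monofun_ext => y; rewrite !flipE.
Qed.

Lemma flip_iso (d d' d'' : Order.disp_t) (S : finPOrderType d)
    (T : finPOrderType d') (U : porderType d'') :
  poset_iso (monofun S (monofun T U)) (monofun T (monofun S U)).
Proof.
by apply: poset_iso_of_cancel; [exact: homo_flip | exact: homo_flip
  | exact: flipK | exact: flipK].
Qed.

(** * The cycles of a permutation as a quotient of the cube *)

Section Quotient.
Variables (A : finType) (s : {perm A}).

Fact orb_subproof (x : cube A) :
  porbit (cube_perm s) x \in porbits (cube_perm s).
Proof. exact: imset_f. Qed.

Definition orb (x : cube A) : cycl s := Cycl (orb_subproof x).

Lemma orb_mem (C : cycl s) x : x \in cycl_set C -> orb x = C.
Proof. by move=> xC; apply: val_inj; rewrite /= -(cyclE xC). Qed.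

Lemma homo_orb : {homo orb : x y / x <= y}.
Proof. by move=> x y xy; apply/cycl_leP; exists x, y; rewrite !porbit_id. Qed.

Lemma orb_cube_perm x : orb (cube_perm s x) = orb x.
Proof. by apply: orb_mem; rewrite /= (mem_porbit _ 1). Qed.

Lemma orb_surj (C : cycl s) : exists x, orb x == C.
Proof.
case: C => C C_orb; case/imsetP: (C_orb) => x _ CE.
by exists x; apply/eqP/orb_mem; rewrite /= CE porbit_id.
Qed.

Definition orb_repr (C : cycl s) : cube A := xchoose (orb_surj C).

Lemma orb_reprK : cancel orb_repr orb.
Proof. by move=> C; apply/eqP/(xchooseP (orb_surj C)). Qed.

Lemma invariant_orb (T : Type) (g : cube A -> T) :
  (forall x, g (cube_perm s x) = g x) ->
  forall x y, orb x = orb y -> g x = g y.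
Proof.
move=> gI x y /(congr1 (@cycl_set _ s))/= xy.
have /porbitP[i ->] : x \in porbit (cube_perm s) y by rewrite -xy porbit_id.
elim: i => [|i IHi]; first by rewrite perm1.
by rewrite expgSr permM gI.
Qed.

Section Lift.
Variables (d : Order.disp_t) (T : porderType d) (g : cube A -> T).
Hypotheses (gM : {homo g : x y / x <= y})
           (gI : forall x, g (cube_perm s x) = g x).

(** The order on cycles compares some elements of the cycles, not the chosen
   representatives; invariance lets [g] be computed at the former. *)
Fact lift_homo : {homo g \o orb_repr : C C' / C <= C'}.
Proof.
move=> C C' /cycl_leP[x [y [xC yC' xy]]] /=.
rewrite (invariant_orb gI (y := x)); last by rewrite orb_reprK (orb_mem xC).
rewrite [leRHS](invariant_orb gI (y := y)) ?gM //.
by rewrite orb_reprK (orb_mem yC').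
Qed.

Definition lift : monofun (cycl s) T := mono_fun lift_homo.

(** With [homo_orb] and [orb_surj], this is the universal property of
    [cycl s] as the quotient of the cube by [s]. *)
Lemma liftE x : lift (orb x) = g x.
Proof. by rewrite mono_funE; apply: (invariant_orb gI); rewrite orb_reprK. Qed.

End Lift.

Lemma monofun_cycl_ext (d : Order.disp_t) (T : porderType d)
    (F G : monofun (cycl s) T) : (forall x, F (orb x) = G (orb x)) -> F = G.
Proof. by move=> FG; apply: monofun_ext => C; rewrite -(orb_reprK C). Qed.

Lemma le_monofun_cyclP (d : Order.disp_t) (T : porderType d)
    (F G : monofun (cycl s) T) :
  reflect (forall x, F (orb x) <= G (orb x)) (F <= G).
Proof.
apply: (iffP (le_monofunP F G)) => FG x; first exact: FG.
by rewrite -(orb_reprK x).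
Qed.

Lemma fix_mbf_invariant (f : fix_mbf s) x : f (cube_perm s x) = f x.
Proof. by case: f => f /= /fix_mbfP. Qed.

Lemma fix_mbfX (f : fix_mbf s) n x : f ((cube_perm s ^+ n)%g x) = f x.
Proof.
elim: n => [|n IHn]; first by rewrite expg0 perm1.
by rewrite expgSr permM fix_mbf_invariant.
Qed.

Definition fix_of (g : mbf A) (gI : forall x, g (cube_perm s x) = g x) :
  fix_mbf s := FixMbf (introT (fix_mbfP s g) gI).

Lemma fix_mbf_ext (f g : fix_mbf s) : (forall x, f x = g x) -> f = g.
Proof. by move=> fg; apply/val_inj/monofun_ext. Qed.

Lemma le_fix_mbfP (f g : fix_mbf s) :
  reflect (forall x, f x <= g x) (f <= g).
Proof. by rewrite le_fix_mbfE; apply: forallP. Qed.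

(** The universal property for maps to [bool]: composition with [orb] is
    inverse to [lift]. *)
Lemma fix_mbf_iso : poset_iso (fix_mbf s) (monofun (cycl s) bool).
Proof.
have GM (G : monofun (cycl s) bool) : {homo G \o orb : x y / x <= y}.
  by move=> x y /homo_orb /monofunP; apply.
have GI (G : monofun (cycl s) bool) x :
    mono_fun (GM G) (cube_perm s x) = mono_fun (GM G) x.
  by rewrite !mono_funE /= orb_cube_perm.
apply: (@poset_iso_of_cancel _ _ _ _
          (fun f : fix_mbf s => lift (@monofunP _ _ _ _ f) (fix_mbf_invariant f))
          (fun G => fix_of (GI G))).
- move=> f g /le_fix_mbfP fg; apply/le_monofun_cyclP => x.
  by rewrite !liftE.
- move=> F G /le_monofun_cyclP FG; apply/le_fix_mbfP => x.
  by rewrite !mono_funE /=.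
- by move=> f; apply: fix_mbf_ext => x; rewrite mono_funE /comp liftE.
- by move=> G; apply: monofun_cycl_ext => x; rewrite liftE mono_funE.
Qed.

End Quotient.

(** * Orders of permutations with coprime cycle lengths *)

(** The order divides the product of the cycle lengths, because each cycle
    returns to its start after a multiple of its length. *)
Lemma perm_order_dvd_prod (A : finType) (s : {perm A}) :
  (#[s]%g %| \prod_(C in porbits s) #|C|)%N.
Proof.
rewrite order_dvdn; apply/eqP/permP => a; rewrite perm1.
rewrite (bigD1 (porbit s a)) ?imset_f //=.
set c := #|_|; set e := (\prod_(_ in _ | _) _)%N.
have sca : (s ^+ c)%g a = a by rewrite permX iter_porbit.
rewrite expgM; elim: e => [|e IHe]; first by rewrite expg0 perm1.
by rewrite expgS permM sca.
Qed.

Lemma coprime_perm_orders (A A' : finType) (p : {perm A}) (r : {perm A'}) :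
  (forall (C : {set A}) (C' : {set A'}),
     C \in porbits p -> C' \in porbits r -> coprime #|C| #|C'|) ->
  coprime #[p]%g #[r]%g.
Proof.
move=> cop; apply: (coprime_dvdl (perm_order_dvd_prod p)).
apply: (coprime_dvdr (perm_order_dvd_prod r)).
elim/big_ind: _ => [|a b ca cb|C pC]; rewrite ?coprime1n ?coprimeMl ?ca //.
elim/big_ind: _ => [|a b ca cb|C' rC']; rewrite ?coprimen1 ?coprimeMr ?ca //.
exact: cop.
Qed.

Lemma cube_perm_order (A : finType) (s : {perm A}) :
  (cube_perm s ^+ #[s] = 1)%g.
Proof.
have cube_permX i x a : (cube_perm s ^+ i)%g x a = x ((s ^+ i)%g a).
  elim: i x a => [|i IHi] x a; first by rewrite !expg0 !perm1.
  by rewrite expgS permM IHi permE ffunE expgSr permM.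
by apply/permP => x; apply/ffunP => a; rewrite cube_permX expg_order !perm1.
Qed.

(** Chinese remainder theorem on the exponents, each of which only matters
    modulo the order of its permutation. *)
Lemma coprime_cube_powers (A A' : finType) (p : {perm A}) (r : {perm A'}) i j :
  coprime #[p]%g #[r]%g ->
  exists n, (cube_perm p ^+ n = cube_perm p ^+ i)%g /\
            (cube_perm r ^+ n = cube_perm r ^+ j)%g.
Proof.
move=> cop; exists (chinese #[p]%g #[r]%g i j).
split; rewrite -(expg_mod _ (cube_perm_order _)).
  by rewrite chinese_modl // expg_mod ?cube_perm_order.
by rewrite chinese_modr // expg_mod ?cube_perm_order.
Qed.

(** * The block permutation on a product of two cubes *)

Section Blocks.
Variables (k m : nat).

Definition join (x : cube 'I_k) (y : cube 'I_m) : cube 'I_(k + m) :=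
  [ffun i => match split i with inl a => x a | inr b => y b end].

Definition left_half (z : cube 'I_(k + m)) : cube 'I_k :=
  [ffun a => z (lshift m a)].

Definition right_half (z : cube 'I_(k + m)) : cube 'I_m :=
  [ffun b => z (rshift k b)].

Lemma join_halves z : join (left_half z) (right_half z) = z.
Proof.
apply/ffunP => i; rewrite ffunE -[in RHS](splitK i).
by case: (split i) => a; rewrite ffunE.
Qed.

Lemma left_half_join x y : left_half (join x y) = x.
Proof. by apply/ffunP => a; rewrite !ffunE (unsplitK (inl a)). Qed.

Lemma right_half_join x y : right_half (join x y) = y.
Proof. by apply/ffunP => a; rewrite !ffunE (unsplitK (inr a)). Qed.

Lemma homo_join x x' y y' : x <= x' -> y <= y' -> join x y <= join x' y'.
Proof.
move=> /forallP xx' /forallP yy'; apply/forallP => i; rewrite !ffunE.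
by case: (split i).
Qed.

Lemma homo_left_half : {homo left_half : z z' / z <= z'}.
Proof. by move=> z z' /forallP zz'; apply/forallP => a; rewrite !ffunE. Qed.

Lemma homo_right_half : {homo right_half : z z' / z <= z'}.
Proof. by move=> z z' /forallP zz'; apply/forallP => a; rewrite !ffunE. Qed.

Variables (p : 'S_k) (r : 'S_m).

Lemma block_perm_join x y :
  cube_perm (block_perm p r) (join x y) =
  join (cube_perm p x) (cube_perm r y).
Proof.
apply/ffunP => i; rewrite permE !ffunE permE /block_fun.
by case: (split i) => a; rewrite (unsplitK (inl _), unsplitK (inr _)) permE ffunE.
Qed.

Lemma block_permX_join n x y :
  (cube_perm (block_perm p r) ^+ n)%g (join x y) =
  join ((cube_perm p ^+ n)%g x) ((cube_perm r ^+ n)%g y).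
Proof.
elim: n => [|n IHn]; first by rewrite !expg0 !perm1.
by rewrite !expgSr !permM IHn block_perm_join.
Qed.

Section Coprime.
Hypothesis cop : coprime #[p]%g #[r]%g.
Implicit Type f : fix_mbf (block_perm p r).

(** [n] is congruent to [1] modulo the order of [p] and to [0] modulo that of
    [r], so the [n]-th power of the block permutation moves only the left
    half, where it acts as [p]. *)
Lemma fix_block_left f x y : f (join (cube_perm p x) y) = f (join x y).
Proof.
have [n [pn rn]] := coprime_cube_powers 1 0 cop.
by rewrite -(fix_mbfX f n (join x y)) block_permX_join pn rn perm1.
Qed.

Lemma fix_block_right f x y : f (join x (cube_perm r y)) = f (join x y).
Proof.
have [n [pn rn]] := coprime_cube_powers 0 1 cop.
by rewrite -(fix_mbfX f n (join x y)) block_permX_join pn rn perm1.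
Qed.

Fact section_homo f y : {homo (fun x => f (join x y)) : x x' / x <= x'}.
Proof. by move=> x x' xx'; apply/monofunP/homo_join. Qed.

Fact section_invariant f y x :
  mono_fun (section_homo f y) (cube_perm p x) = mono_fun (section_homo f y) x.
Proof. by rewrite !mono_funE fix_block_left. Qed.

Definition block_section f y : fix_mbf p := fix_of (section_invariant f y).

Lemma block_sectionE f y x : block_section f y x = f (join x y).
Proof. exact: mono_funE. Qed.

Fact block_section_homo f : {homo block_section f : y y' / y <= y'}.
Proof.
move=> y y' yy'; apply/le_fix_mbfP => x; rewrite !block_sectionE.
exact/monofunP/homo_join.
Qed.

Fact block_section_invariant f y :
  block_section f (cube_perm r y) = block_section f y.
Proof. by apply: fix_mbf_ext => x; rewrite !block_sectionE fix_block_right. Qed.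

(** Invariance of [f] under [r] alone is what makes its sections depend only
    on the cycle of [y]. *)
Definition block_curry f : monofun (cycl r) (fix_mbf p) :=
  lift (@block_section_homo f) (@block_section_invariant f).

Lemma block_curryE f x y : block_curry f (orb r y) x = f (join x y).
Proof. by rewrite liftE block_sectionE. Qed.

Implicit Type G : monofun (cycl r) (fix_mbf p).

(** Moves the left half first, at a fixed cycle, then the cycle: the first step
   uses that values of [G] are monotone, the second that [G] is. *)
Fact uncurry_homo G :
  {homo (fun z => G (orb r (right_half z)) (left_half z)) : z z' / z <= z'}.
Proof.
move=> z z' zz'; apply: (@le_trans _ _ (G (orb r (right_half z)) (left_half z'))).
  exact/monofunP/homo_left_half.
by move/homo_right_half/(homo_orb r)/(@monofunP _ _ _ _ G)/le_fix_mbfP: zz'.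
Qed.

Fact uncurry_invariant G z :
  mono_fun (uncurry_homo G) (cube_perm (block_perm p r) z) =
  mono_fun (uncurry_homo G) z.
Proof.
rewrite !mono_funE -{1 2}(join_halves z) block_perm_join.
by rewrite left_half_join right_half_join orb_cube_perm fix_mbf_invariant.
Qed.

Definition block_uncurry G : fix_mbf (block_perm p r) :=
  fix_of (uncurry_invariant G).

Lemma block_uncurryE G z :
  block_uncurry G z = G (orb r (right_half z)) (left_half z).
Proof. exact: mono_funE. Qed.

Lemma fix_block_iso :
  poset_iso (fix_mbf (block_perm p r)) (monofun (cycl r) (fix_mbf p)).
Proof.
apply: (@poset_iso_of_cancel _ _ _ _ block_curry block_uncurry).
- move=> f g /le_fix_mbfP fg; apply/le_monofun_cyclP => y.
  by apply/le_fix_mbfP => x; rewrite !block_curryE.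
- move=> F G /le_monofun_cyclP FG; apply/le_fix_mbfP => z.
  by rewrite !block_uncurryE; move/le_fix_mbfP: (FG (right_half z)).
- by move=> f; apply: fix_mbf_ext => z;
    rewrite block_uncurryE block_curryE join_halves.
- move=> G; apply: monofun_cycl_ext => y; apply: fix_mbf_ext => x.
  by rewrite block_curryE block_uncurryE left_half_join right_half_join.
Qed.

End Coprime.
End Blocks.

(** * The two isomorphisms *)

(** Currying: by [fix_mbf_iso], both sides are posets of monotone maps in two
    arguments, one in [cycl p] and one in [cycl r], with values in [bool]. *)
Lemma monofun_cycl_fix_iso (A A' : finType) (p : {perm A}) (r : {perm A'}) :
  poset_iso (monofun (cycl r) (fix_mbf p)) (monofun (cycl p) (fix_mbf r)).
Proof.
apply: poset_iso_trans (monofun_iso _ (fix_mbf_iso p)) _.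
apply: poset_iso_trans (flip_iso _ _ _) _.
exact/monofun_iso/poset_iso_sym/fix_mbf_iso.
Qed.

Theorem lemma3 (k m : nat) (k_gt0 : (0 < k)%N) (m_gt0 : (0 < m)%N)
    (p : 'S_k) (r : 'S_m)
    (coprime_cycles : forall (C : {set 'I_k}) (C' : {set 'I_m}),
       C \in porbits p -> C' \in porbits r -> coprime #|C| #|C'|) :
  poset_iso (fix_mbf (block_perm p r)) (monofun (cycl r) (fix_mbf p)) /\
  poset_iso (monofun (cycl r) (fix_mbf p)) (monofun (cycl p) (fix_mbf r)).
Proof.
split; last exact: monofun_cycl_fix_iso.
exact/fix_block_iso/coprime_perm_orders.
Qed.
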